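(* Let $\sigma\in\{\mathrm{gKMP},\mathrm{dKMP},\mathrm{Harm}\}$, with $\mathfrak{s}>0$ if $\sigma=\mathrm{gKMP}$ and $\mathfrak{s}\ge1/2$ if $\sigma=\mathrm{Harm}$. Then the model $\sigma$ is of gradient type: for every $x\in\mathbb{T}_N$ and $\eta\in\Omega_N^\sigma$, $$L_{x,x+1}^\sigma\eta_x=D_\sigma(\eta_{x+1}-\eta_x),\qquad D_{\mathrm{gKMP}}=D_{\mathrm{dKMP}}=\frac12,\quad D_{\mathrm{Harm}}=\frac1{2\mathfrak{s}},$$ and consequently $$N^2L_N^\sigma\eta_x=D_\sigma N^2\big(\eta_{x+1}+\eta_{x-1}-2\eta_x\big).$$
   Context: $\mathbb{N}_0=\{0,1,\dots\}$, $\mathbb{R}_+=[0,\infty)$; for an integer $N\ge2$, $\mathbb{T}_N=\mathbb{Z}/N\mathbb{Z}\cong\{0,\dots,N-1\}$. $\Gamma$ is the Gamma function; $\delta_x$ is the configuration equal to $1$ at $x$ and $0$ elsewhere. $L\eta_x$ means $L$ applied (through the formulas below) to the coordinate function $\eta\mapsto\eta_x$, evaluated at $\eta$. Each model has generator $L_N^\sigma=\sum_{x\in\mathbb{T}_N}L_{x,x+1}^\sigma$. (gKMP, parameter $\mathfrak{s}>0$.) $\Omega_N^{\mathrm{gKMP}}=\mathbb{R}_+^{\mathbb{T}_N}$ and $L_{x,x+1}^{\mathrm{gKMP}}f(\eta)=\int_0^1\gamma_{\mathfrak{s}}(u)[f(\eta^{x,x+1,u})-f(\eta)]du$, with $\gamma_{\mathfrak{s}}(u)=\frac{\Gamma(4\mathfrak{s})}{\Gamma(2\mathfrak{s})^2}u^{2\mathfrak{s}-1}(1-u)^{2\mathfrak{s}-1}$,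 $(\eta^{x,y,u})_x=u(\eta_x+\eta_y)$, $(\eta^{x,y,u})_y=(1-u)(\eta_x+\eta_y)$, $(\eta^{x,y,u})_z=\eta_z$ for $z\ne x,y$. (dKMP.) $\Omega_N^{\mathrm{dKMP}}=\mathbb{N}_0^{\mathbb{T}_N}$ and $L_{x,x+1}^{\mathrm{dKMP}}f(\eta)=\frac1{\eta_x+\eta_{x+1}+1}\sum_{r=0}^{\eta_x+\eta_{x+1}}[f(\eta^{(x,r)})-f(\eta)]$, where $\eta^{(x,r)}$ is obtained from $\eta$ by replacing $\eta_x$ by $r$ and $\eta_{x+1}$ by $\eta_x+\eta_{x+1}-r$. (Harm, spin $\mathfrak{s}$.) $\Omega_N^{\mathrm{Harm}}=\mathbb{N}_0^{\mathbb{T}_N}$ and $L_{x,x+1}^{\mathrm{Harm}}=\nabla_{x,x+1}^{\mathrm{Harm}}+\nabla_{x+1,x}^{\mathrm{Harm}}$, where $\nabla_{x,y}^{\mathrm{Harm}}f(\eta)=\sum_{k=1}^{\eta_x}\frac{\Gamma(\eta_x+1)\Gamma(\eta_x-k+2\mathfrak{s})}{k\,\Gamma(\eta_x-k+1)\Gamma(\eta_x+2\mathfrak{s})}[f(\eta-k\delta_x+k\delta_y)-f(\eta)]$. *)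

(* Defs.v *)
From mathcomp Require Import all_boot all_order all_algebra.
From mathcomp Require Import all_classical all_reals all_analysis.
Set Implicit Arguments.
Unset Strict Implicit.
Unset Printing Implicit Defensive.
Import Order.TTheory GRing.Theory Num.Theory.
Import numFieldNormedType.Exports.
Local Open Scope classical_set_scope.
Local Open Scope ring_scope.

(* Euler's integral; only meaningful for 0 < a. *)
Definition Gamma (R : realType) (a : R) : R :=
  \int[@lebesgue_measure R]_(t in `]0, +oo[) (t `^ (a - 1) * expR (- t)).

(* The real argument of gKMP and Harm is the parameter s of the model. *)
Inductive model (R : Type) : Type := gKMP of R | dKMP | Harm of R.
Arguments dKMP {R}.

Definition admissible (R : realType) (sigma : model R) : Prop :=
  match sigma with
  | gKMP s => 0 < s
  | dKMP => True
  | Harm s => 1 / 2 <= s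
  end.

Definition diffusivity (R : realType) (sigma : model R) : R :=
  match sigma with
  | gKMP _ => 1 / 2
  | dKMP => 1 / 2
  | Harm s => 1 / (2 * s)
  end.

Definition occupation (R : realType) (sigma : model R) : Type :=
  match sigma with gKMP _ => R | dKMP => nat | Harm _ => nat end.

(* The torus Z/NZ is 'Z_N, which has N elements only when 1 < N. *)
Definition config (R : realType) (N : nat) (sigma : model R) : Type :=
  {ffun 'Z_N -> occupation sigma}.

(* For gKMP, [config] contains all real-valued configurations; Omega cuts out
   the nonnegative ones, a set preserved by [kmp_move x y u] for 0 <= u <= 1. *)
Definition Omega (R : realType) (N : nat) (sigma : model R) :
    set (config N sigma) :=
  match sigma return set (config N sigma) with
  | gKMP _ => [set eta : {ffun 'Z_N -> R} | forall z, 0 <= eta z]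
  | dKMP => setT
  | Harm _ => setT
  end.

Definition coordinate (R : realType) (N : nat) (sigma : model R) (x : 'Z_N) :
    config N sigma -> R :=
  match sigma return config N sigma -> R with
  | gKMP _ => fun eta : {ffun 'Z_N -> R} => eta x
  | dKMP => fun eta : {ffun 'Z_N -> nat} => (eta x)%:R
  | Harm _ => fun eta : {ffun 'Z_N -> nat} => (eta x)%:R
  end.

Definition kmp_density (R : realType) (s u : R) : R :=
  Gamma (4 * s) / Gamma (2 * s) ^+ 2
  * u `^ (2 * s - 1) * (1 - u) `^ (2 * s - 1).

Definition kmp_move (R : realType) (N : nat) (x y : 'Z_N) (u : R)
    (eta : {ffun 'Z_N -> R}) : {ffun 'Z_N -> R} :=
  [ffun z => if z == x then u * (eta x + eta y)
             else if z == y then (1 - u) * (eta x + eta y)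
             else eta z].

Definition gKMP_bond (R : realType) (N : nat) (s : R) (x : 'Z_N)
    (f : {ffun 'Z_N -> R} -> R) (eta : {ffun 'Z_N -> R}) : R :=
  \int[@lebesgue_measure R]_(u in `[0, 1])
    (kmp_density s u * (f (kmp_move x (x + 1) u eta) - f eta)).

(* In the sum below r <= eta x + eta (x + 1), so the truncated subtraction
   is exact. *)
Definition dkmp_move (N : nat) (x : 'Z_N) (r : nat)
    (eta : {ffun 'Z_N -> nat}) : {ffun 'Z_N -> nat} :=
  [ffun z => if z == x then r
             else if z == (x + 1)%R then (eta x + eta (x + 1)%R - r)%N
             else eta z].

Definition dKMP_bond (R : realType) (N : nat) (x : 'Z_N)
    (f : {ffun 'Z_N -> nat} -> R) (eta : {ffun 'Z_N -> nat}) : R :=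
  1 / (eta x + eta (x + 1)%R + 1)%N%:R *
  \sum_(0 <= r < (eta x + eta (x + 1)%R).+1) (f (dkmp_move x r eta) - f eta).

(* The configuration eta - k delta_x + k delta_y, for k <= eta x. *)
Definition jump (N : nat) (x y : 'Z_N) (k : nat)
    (eta : {ffun 'Z_N -> nat}) : {ffun 'Z_N -> nat} :=
  [ffun z => (eta z - k * (z == x) + k * (z == y))%N].

Definition nabla_Harm (R : realType) (N : nat) (s : R) (x y : 'Z_N)
    (f : {ffun 'Z_N -> nat} -> R) (eta : {ffun 'Z_N -> nat}) : R :=
  \sum_(1 <= k < (eta x).+1)
    (Gamma ((eta x)%:R + 1) * Gamma ((eta x)%:R - k%:R + 2 * s))
    / (k%:R * Gamma ((eta x)%:R - k%:R + 1) * Gamma ((eta x)%:R + 2 * s))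
    * (f (jump x y k eta) - f eta).

Definition Harm_bond (R : realType) (N : nat) (s : R) (x : 'Z_N)
    (f : {ffun 'Z_N -> nat} -> R) (eta : {ffun 'Z_N -> nat}) : R :=
  nabla_Harm s x (x + 1) f eta + nabla_Harm s (x + 1) x f eta.

(* [bond_generator sigma x] is the operator of the bond (x, x + 1). *)
Definition bond_generator (R : realType) (N : nat) (sigma : model R)
    (x : 'Z_N) : (config N sigma -> R) -> config N sigma -> R :=
  match sigma return (config N sigma -> R) -> config N sigma -> R with
  | gKMP s => gKMP_bond s x
  | dKMP => @dKMP_bond R N x
  | Harm s => Harm_bond s x
  end.

Definition generator (R : realType) (N : nat) (sigma : model R)
    (f : config N sigma -> R) (eta : config N sigma) : R :=
  \sum_(x : 'Z_N) bond_generator x f eta.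

(* Main.v *)
Require Import Defs.
From mathcomp Require Import all_boot all_order all_algebra.
From mathcomp Require Import all_classical all_reals all_analysis.
From mathcomp Require Import measurable_realfun ring lra.
Set Implicit Arguments.
Unset Strict Implicit.
Unset Printing Implicit Defensive.
Import Order.TTheory GRing.Theory Num.Theory.
Import numFieldNormedType.Exports.
Local Open Scope classical_set_scope.
Local Open Scope ring_scope.

(** Each bond conserves the mass of its two sites, so the action on a coordinate
    reduces to a first moment of the redistribution law. For the two KMP models
    that law is symmetric: an average fraction 1/2 of the total mass
    [eta x + eta (x + 1)] ends at [x], and the drift of [eta x] is half the
    difference ([dKMP_bond_coordinate], [gKMP_bond_coordinate]). For the
    harmonic model, particles leave a site holding [n] of them at mean rate
    [n / (2 * s)] in each direction ([harm_first_moment]), and the drift is the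
    difference of two such rates. The generator at a site collects the two
    bonds that contain it, which turns the gradient into a discrete Laplacian
    ([generator_coordinate]).

    The analytic content is that the constants of the models are the right
    ones, and this rests on Euler's formula
    Gamma a * Gamma b = Gamma (a + b) * B(a, b), proved in [eGammaM] by Tonelli
    and an affine change of variables, as an identity between possibly infinite
    integrals. With Gamma 1 = 1 and B(a, 1) = 1 / a ([eBeta1]), the case b = 1
    is the recurrence Gamma (a + 1) = a * Gamma a, from which finiteness on the
    positive reals follows; positivity comes from a comparison with B(a, 1).
    The case a = b = 2s of Euler's formula says that the weight of gKMP is a
    probability density, and its mean 1/2 is B(2s + 1, 2s) / B(2s, 2s), which
    the recurrence evaluates. The rates of the harmonic model only involve ratios
    of Gamma values, so that the recurrence alone determines their first
    moment. *)

(** * Affine changes of variables *)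

Section affine.
Context (R : realType).
Local Notation mu := (@lebesgue_measure R).

Let affine (c d : R) (x : measurableTypeR R) : measurableTypeR R := c * x + d.

Let measurable_affine (c d : R) :
  measurable_fun [set: measurableTypeR R] (affine c d).
Proof.
by apply: measurable_funD; [exact: mulrl_measurable|exact: measurable_cst].
Qed.

(** Both sides are measures that give an interval ]a, b] its length, and such a
    measure is unique. *)
Lemma lebesgue_measure_affine (c d : R) (c0 : 0 < c) (A : set R) :
  measurable A -> mu A = (c%:E * mu ((fun x => c * x + d)%R @^-1` A))%E.
Proof.
pose m := mscale (NngNum (ltW c0)) (pushforward mu (affine c d)).
move=> mA; have -> // : mu A = m (measurable_affine c d) A.
apply: lebesgue_measure_unique => // _ [[a b] _ <-].
change (mu `]a, b] = (c%:E * mu (affine c d @^-1` `]a, b]))%E).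
rewrite (_ : _ @^-1` _ = `](a - d) / c, (b - d) / c]%classic); last first.
  apply/seteqP; split=> x /=; rewrite !in_itv /= ltr_pdivrMr // ler_pdivlMr //;
    by rewrite ltrBlDr lerBrDr mulrC.
rewrite !lebesgue_measure_itv /= !lte_fin ltr_pM2r ?invr_gt0 // ltrD2r.
case: ifPn => _; last by rewrite mule0.
by rewrite -!EFinB -EFinM; congr EFin; field; rewrite gt_eqF.
Qed.

Lemma ge0_integral_affine (c d : R) (c0 : 0 < c) (f : R -> \bar R) :
  measurable_fun [set: R] f -> (forall x, 0 <= f x)%E ->
  (\int[mu]_x f x = c%:E * \int[mu]_x f (c * x + d)%R)%E.
Proof.
move=> mf f0.
have -> : (\int[mu]_x f (c * x + d)%R =
    \int[pushforward mu (affine c d)]_y f y)%E.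
  by rewrite ge0_integral_pushforward // => x _; exact: f0.
pose c' := NngNum (ltW c0).
rewrite -[c]/(c'%:num)%R -ge0_integral_mscale //.
apply: eq_measure_integral => A mA _.
exact: (lebesgue_measure_affine d c0 mA).
Qed.

End affine.

(** * The Euler integrals and their product formula *)

Section gamma_beta.
Context (R : realType).
Local Notation mu := (@lebesgue_measure R).
Implicit Types a b t u r s : R.

(** The integrands are extended by 0 to the whole line, so that changes of
    variables carry no integration domain along. *)
Definition gamma_integrand a : R -> R :=
  (fun t => t `^ (a - 1) * expR (- t)) \_ `]0, +oo[.

Definition beta_integrand a b : R -> R :=
  (fun u => u `^ (a - 1) * (1 - u) `^ (b - 1)) \_ `]0, 1[.

(** The extended real integrals: Tonelli applies to them before anything is
    known about convergence. *)
Definition eGamma a : \bar R := (\int[mu]_t (gamma_integrand a t)%:E)%E.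

Definition eBeta a b : \bar R := (\int[mu]_u (beta_integrand a b u)%:E)%E.

Lemma gamma_integrandE a t :
  gamma_integrand a t = if 0 < t then t `^ (a - 1) * expR (- t) else 0.
Proof. by rewrite /gamma_integrand patchE mem_setE in_itv /= andbT. Qed.

Lemma beta_integrandE a b u :
  beta_integrand a b u =
  if 0 < u < 1 then u `^ (a - 1) * (1 - u) `^ (b - 1) else 0.
Proof. by rewrite /beta_integrand patchE mem_setE in_itv. Qed.

Lemma gamma_integrand_ge0 a t : 0 <= gamma_integrand a t.
Proof.
rewrite gamma_integrandE; case: ifP => // _.
by rewrite mulr_ge0 ?powR_ge0 ?expR_ge0.
Qed.

Lemma beta_integrand_ge0 a b u : 0 <= beta_integrand a b u.
Proof.
by rewrite beta_integrandE; case: ifP => // _; rewrite mulr_ge0 ?powR_ge0.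
Qed.

Lemma measurable_gamma_integrand a : measurable_fun setT (gamma_integrand a).
Proof.
apply/(measurable_restrictT _ (measurable_itv _)); apply: measurable_funTS.
apply: measurable_funM; first exact: measurable_powR.
by apply: measurableT_comp => //; exact: measurable_expR.
Qed.

Lemma measurable_beta_integrand a b :
  measurable_fun setT (beta_integrand a b).
Proof.
apply/(measurable_restrictT _ (measurable_itv _)); apply: measurable_funTS.
apply: measurable_funM; first exact: measurable_powR.
apply: (@measurableT_comp _ _ _ _ _ _ (@powR R ^~ (b - 1)) _ (fun u => 1 - u)).
  exact: measurable_powR.
exact: measurable_funB.
Qed.

(** The substitution t = r * u in the convolution of two Gamma integrands
    separates the variables [r] and [u]. *)
Lemma gamma_integrand_beta_integrand a b r u : 0 < r ->
  r * (gamma_integrand a (r * u) * gamma_integrand b (r - r * u)) =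
  gamma_integrand (a + b) r * beta_integrand a b u.
Proof.
move=> r0; rewrite !gamma_integrandE beta_integrandE r0 pmulr_rgt0 //.
rewrite (_ : r - r * u = r * (1 - u)); last by ring.
rewrite pmulr_rgt0 // subr_gt0.
case: ltP => u0 /=; last by rewrite mul0r !mulr0.
case: ltP => u1 /=; last by rewrite !mulr0.
rewrite !powRM ?(ltW r0) ?(ltW u0) ?subr_ge0 ?(ltW u1) //.
have -> : r `^ (a + b - 1) = r * (r `^ (a - 1) * r `^ (b - 1)).
  rewrite -powRD ?(gt_eqF r0) ?implybT // -{2}(powRr1 (ltW r0)).
  by rewrite -powRD ?(gt_eqF r0) ?implybT //; congr (_ `^ _); ring.
have -> : expR (- r) = expR (- (r * u)) * expR (- (r * (1 - u))).
  by rewrite -expRD; congr expR; ring.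
ring.
Qed.

(** Euler's product formula. Translating the second integral makes the product
    the double integral of [h], and integrating first over [s] for fixed [r]
    leaves the Beta integral after the scaling s = r * u. *)
Lemma eGammaM a b : (eGamma a * eGamma b = eGamma (a + b) * eBeta a b)%E.
Proof.
have g0 c x : (0 <= (gamma_integrand c x)%:E)%E.
  by rewrite lee_fin gamma_integrand_ge0.
have b0 x : (0 <= (beta_integrand a b x)%:E)%E.
  by rewrite lee_fin beta_integrand_ge0.
have mg c : measurable_fun setT (EFin \o gamma_integrand c).
  by apply/measurable_EFinP; exact: measurable_gamma_integrand.
have mb : measurable_fun setT (EFin \o beta_integrand a b).
  by apply/measurable_EFinP; exact: measurable_beta_integrand.
pose h (z : R * R) := (gamma_integrand a z.1 * gamma_integrand b (z.2 - z.1))%R.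
have mh : measurable_fun setT h.
  apply: measurable_funM.
    by apply: (measurableT_comp (measurable_gamma_integrand a)).
  apply: (measurableT_comp (measurable_gamma_integrand b)).
  by apply: measurable_funB.
have h0 z : (0 <= (h z)%:E)%E.
  by rewrite lee_fin mulr_ge0 // gamma_integrand_ge0.
have mh1 s : measurable_fun setT (fun r => (h (s, r))%:E).
  by apply/measurable_EFinP; exact: (measurable_fun_pair2 s mh).
have mh2 r : measurable_fun setT (fun s => (h (s, r))%:E).
  by apply/measurable_EFinP; exact: (measurable_fun_pair1 r mh).
have inner1 s : ((gamma_integrand a s)%:E * eGamma b =
    \int[mu]_r (h (s, r))%:E)%E.
  have mbs : measurable_fun setT
      (fun r => (gamma_integrand b (1 * r - s)%R)%:E).
    apply: (measurableT_comp (mg b)).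
    by apply: measurable_funD; first exact: mulrl_measurable.
  rewrite /eGamma (ge0_integral_affine (- s) ltr01 (mg b) (g0 b)) mul1e.
  rewrite -(ge0_integralZl mu measurableT mbs (fun x _ => g0 b _) (g0 a s)).
  by apply: eq_integral => r _; rewrite -EFinM /h /= mul1r.
have inner2 r : (\int[mu]_s (h (s, r))%:E =
    (gamma_integrand (a + b) r)%:E * eBeta a b)%E.
  rewrite /eBeta -(ge0_integralZl mu measurableT mb (fun x _ => b0 x) (g0 _ r)).
  have [r0|r0] := ltP 0 r.
    have mhr : measurable_fun setT (fun u => (h (r * u + 0, r)%R)%:E).
      apply: (measurableT_comp (mh2 r)).
      by apply: measurable_funD; first exact: mulrl_measurable.
    rewrite (ge0_integral_affine 0 r0 (mh2 r)); last by move=> s; exact: h0.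
    have r0E : (0 <= r%:E)%E by rewrite lee_fin ltW.
    rewrite -(ge0_integralZl mu measurableT mhr (fun u _ => h0 _) r0E).
    apply: eq_integral => u _.
    by rewrite -!EFinM -gamma_integrand_beta_integrand // /h /= addr0.
  apply: eq_integral => s _; rewrite -EFinM; congr EFin.
  rewrite /h /= !gamma_integrandE [0 < r]ltNge r0 /= mul0r.
  case: ltP => s0; last by rewrite mul0r.
  by rewrite ltNge (_ : r - s <= 0) ?mulr0 // subr_le0 (le_trans r0) // ltW.
have -> : (eGamma a * eGamma b = \int[mu]_s \int[mu]_r (h (s, r))%:E)%E.
  rewrite {1}/eGamma.
  rewrite -(ge0_integralZr mu measurableT (mg a) (fun x _ => g0 a x)) //.
    by apply: eq_integral => s _; exact: inner1.
  exact: integral_ge0.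
have -> : (eGamma (a + b) * eBeta a b =
    \int[mu]_r \int[mu]_s (h (s, r))%:E)%E.
  rewrite {1}/eGamma.
  rewrite -(ge0_integralZr mu measurableT (mg _) (fun x _ => g0 _ x)) //.
    by apply: eq_integral => s _; rewrite inner2.
  exact: integral_ge0.
apply: (@fubini_tonelli _ _ _ _ _ mu mu (EFin \o h)) => //.
by apply/measurable_EFinP.
Qed.

End gamma_beta.

(** * The Gamma function on the positive reals *)

Section gamma_function.
Context (R : realType).
Local Notation mu := (@lebesgue_measure R).
Implicit Types a b e t u : R.

Lemma integral_powR_segment a e : 0 < e < 1 ->
  (\int[mu]_(u in `[e, 1%R]) (a * u `^ (a - 1))%R%:E = (1 - e `^ a)%R%:E)%E.
Proof.
move=> /andP[e0 e1].
have dF u b : 0 < u -> derivable (@powR R ^~ b) u 1.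
  by move=> u0; apply: derivable_powR; rewrite in_itv /= andbT.
have cF u b : 0 < u -> {for u, continuous (@powR R ^~ b)}.
  move=> u0; apply/differentiable_continuous; rewrite -derivable1_diffP.
  exact: dF.
rewrite (@continuous_FTC2 _ _ (@powR R ^~ a)) //; first by rewrite powR1 EFinB.
- apply: derivable_within_continuous => u; rewrite in_itv /= => /andP[eu _].
  by apply: derivableM => //; apply: dF; exact: lt_le_trans eu.
- split.
  + move=> u; rewrite in_itv /= => /andP[eu _].
    by apply: dF; exact: lt_trans eu.
  + by apply: cvg_at_right_filter; exact: cF.
  + by apply: cvg_at_left_filter; exact: cF.
- move=> u; rewrite in_itv /= => /andP[eu _].
  by apply: powR_derive1; rewrite in_itv /= andbT (lt_trans e0).
Qed.

(** For a < 1 the integrand is unbounded at 0: the fundamental theorem of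
    calculus applies on [[1 / (n + 2), 1]], and monotone convergence does the
    rest. *)
Lemma eBeta1 a : 0 < a -> eBeta a 1 = (a^-1)%:E.
Proof.
move=> a0; pose f u : \bar R := (a * u `^ (a - 1))%:E.
have mf D : measurable_fun D f.
  apply: measurable_funTS; apply/measurable_EFinP.
  by apply: measurable_funM => //; exact: measurable_powR.
have f0 u : (0 <= f u)%E by rewrite lee_fin mulr_ge0 ?powR_ge0 // ltW.
pose e n : R := n.+2%:R^-1.
have e0 n : 0 < e n by rewrite invr_gt0.
have e1 n : e n < 1 by rewrite invf_lt1 // ltr1n.
have ecvg : e n @[n --> \oo] --> 0.
  by have := @cvg_harmonic R; rewrite -cvg_shiftS.
pose F n : set R := `[e n, 1]%classic.
have ndF : nondecreasing_seq F.
  move=> m n mn; apply/subsetPset => u; rewrite /F /= !in_itv /=.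
  move=> /andP[mu ->]; rewrite andbT (le_trans _ mu) //.
  by rewrite lef_pV2 ?posrE // ler_nat !ltnS.
have UF : \bigcup_n F n = `]0, 1]%classic.
  apply/seteqP; split=> u; rewrite /F /= in_itv /=.
    move=> [n _]; rewrite /= in_itv /= => /andP[nu ->].
    by rewrite andbT (lt_le_trans _ nu).
  move=> /andP[u0 u1].
  have [n _ /(_ n (leqnn n))] : \forall n \near \oo, e n < u.
    exact: (cvgr_lt 0 ecvg).
  by move=> en; exists n => //=; rewrite in_itv /= u1 ltW.
have h1 : (\int[mu]_(u in `]0%R, 1%R]) f u = 1)%E.
  have lim1 : (\int[mu]_(u in F n) f u)%E @[n --> \oo] --> 1%E.
    under eq_cvg do rewrite integral_powR_segment ?e0 ?e1 //.
    apply: cvg_EFin; first by near=> n.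
    rewrite -[X in _ --> X]subr0; apply: cvgB; first exact: cvg_cst.
    move/cvg_at_rightP : (powR_cvg0 a0); apply; split=> //.
  have lim2 : (\int[mu]_(u in F n) f u)%E @[n --> \oo] -->
      (\int[mu]_(u in \bigcup_n F n) f u)%E.
    apply: ge0_nondecreasing_set_cvg_integral => // n.
    - exact: measurable_itv.
    - exact: mf.
  by rewrite -UF -(cvg_lim _ lim2) // (cvg_lim _ lim1).
have -> : eBeta a 1 = ((a^-1)%:E * \int[mu]_(u in `]0%R, 1%R]) f u)%E.
  rewrite -(integral_itv_bndo_bndc (mf _)) integral_mkcond /eBeta.
  rewrite -(ge0_integralZl mu measurableT).
  - apply: eq_integral => u _.
    rewrite beta_integrandE patchE mem_setE in_itv /=.
    case: ifP => _; last by rewrite mule0.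
    by rewrite -EFinM subrr powRr0 mulr1 mulKf // gt_eqF.
  - by apply/(measurable_restrictT _ (measurable_itv _)).
  - by move=> u _; apply: erestrict_ge0.
  - by rewrite lee_fin invr_ge0 ltW.
by rewrite h1 mule1.
Unshelve. all: by end_near. Qed.


Lemma GammaE a : Gamma a = fine (eGamma a).
Proof.
by rewrite /Gamma /eGamma Rintegral_mkcond.
Qed.

Lemma eGamma1 : eGamma 1 = 1%E :> \bar R.
Proof.
rewrite -(integral_exponential_pdf (ltr01 : 0 < 1 :> R)).
transitivity (\int[mu]_(t in `]0%R, +oo[) (expR (- t))%:E)%E.
  rewrite integral_mkcond; apply: eq_integral => t _.
  rewrite restrict_EFin /= /gamma_integrand !patchE; case: ifP => // _.
  by rewrite subrr powRr0 mul1r.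
rewrite integral_itv_obnd_cbnd; last first.
  apply: measurable_funTS; apply/measurable_EFinP.
  by apply: measurableT_comp => //; exact: measurable_expR.
rewrite integral_mkcond; apply: eq_integral => t _.
rewrite restrict_EFin /= /exponential_pdf !patchE; case: ifP => // _.
by rewrite mul1r mulN1r.
Qed.

(** The product formula at b = 1, where Gamma b = 1 and B(a, b) = 1 / a. *)
Lemma eGamma_recurrence a : 0 < a ->
  eGamma a = (eGamma (a + 1) * (a^-1)%:E)%E.
Proof. by move=> a0; rewrite -eBeta1 // -eGammaM eGamma1 mule1. Qed.

Lemma eGamma_ge0 a : (0 <= eGamma a)%E.
Proof.
by apply: integral_ge0 => t _; rewrite lee_fin gamma_integrand_ge0.
Qed.

(** The recurrence, read from right to left, carries finiteness from n + 1 to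
    n + 2. *)
Lemma eGamma_nat_fin n : eGamma n.+1%:R \is a @fin_num R.
Proof.
elim: n => [|n IH]; first by rewrite eGamma1.
have /eGamma_recurrence E : 0 < n.+1%:R :> R by rewrite ltr0n.
rewrite -natr1; move: IH; rewrite E.
rewrite ge0_fin_numE ?mule_ge0 ?eGamma_ge0 ?lee_fin ?invr_ge0 //.
rewrite ge0_fin_numE ?eGamma_ge0 //.
case: (eGamma _) => [x| |] //; first by rewrite !ltry.
by rewrite gt0_mulye ?lte_fin ?invr_gt0 ?ltr0n.
Qed.

(** Near 0 the exponential is at most 1; beyond 1 a larger exponent makes the
    integrand larger. *)
Lemma gamma_integrand_ub a n t : a <= n.+1%:R ->
  gamma_integrand a t <= beta_integrand a 1 t + gamma_integrand n.+1%:R t.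
Proof.
move=> an; rewrite !gamma_integrandE beta_integrandE.
case: ltP => t0 /=; last by rewrite addr0.
case: ltP => t1; rewrite ?subrr ?powRr0 ?mulr1 ?add0r.
  rewrite ler_wpDr ?mulr_ge0 ?powR_ge0 ?expR_ge0 //.
  by rewrite ler_piMr ?powR_ge0 // -expR0 ler_expR oppr_le0 ltW.
by rewrite ler_wpM2r ?expR_ge0 // ler_powR // lerB.
Qed.

Lemma eGamma_fin a : 0 < a -> eGamma a \is a fin_num.
Proof.
move=> a0; rewrite ge0_fin_numE ?eGamma_ge0 //.
pose n := Num.bound a.
have an : a <= n.+1%:R.
  by rewrite (le_trans (ltW (archi_boundP (ltW a0)))) // ler_nat.
apply: (@le_lt_trans _ _ (eBeta a 1 + eGamma n.+1%:R)%E); last first.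
  rewrite eBeta1 // lte_add_pinfty ?ltry // -ge0_fin_numE ?eGamma_ge0 //.
  exact: eGamma_nat_fin.
have mg b : measurable_fun setT (EFin \o gamma_integrand b).
  by apply/measurable_EFinP; exact: measurable_gamma_integrand.
have mb : measurable_fun setT (EFin \o beta_integrand a 1).
  by apply/measurable_EFinP; exact: measurable_beta_integrand.
rewrite /eBeta /eGamma -(ge0_integralD mu measurableT _ mb _ (mg _)) //.
- apply: ge0_le_integral => //.
  + by move=> t _; rewrite lee_fin gamma_integrand_ge0.
  + exact: mg.
  + exact: (emeasurable_funD mb (mg _)).
  + by move=> t _; rewrite -EFinD lee_fin gamma_integrand_ub.
- by move=> t _; rewrite lee_fin beta_integrand_ge0.
- by move=> t _; rewrite lee_fin gamma_integrand_ge0.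
Qed.

Lemma EFin_Gamma a : 0 < a -> (Gamma a)%:E = eGamma a.
Proof. by move=> a0; rewrite GammaE fineK // eGamma_fin. Qed.

(** On ]0, 1[ the exponential is at least exp(-1), so that Gamma a is at least
    exp(-1) * B(a, 1). *)
Lemma Gamma_gt0 a : 0 < a -> 0 < Gamma a.
Proof.
move=> a0; rewrite -lte_fin EFin_Gamma //.
have mg : measurable_fun setT (EFin \o gamma_integrand a).
  by apply/measurable_EFinP; exact: measurable_gamma_integrand.
have mb : measurable_fun setT (EFin \o beta_integrand a 1).
  by apply/measurable_EFinP; exact: measurable_beta_integrand.
apply: (@lt_le_trans _ _ ((expR (-1))%:E * eBeta a 1)%E).
  by rewrite eBeta1 // -EFinM lte_fin mulr_gt0 ?expR_gt0 ?invr_gt0.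
have b0 u : (0 <= (beta_integrand a 1 u)%:E)%E.
  by rewrite lee_fin beta_integrand_ge0.
have e0 : (0 <= (expR (- 1))%:E :> \bar R)%E by rewrite lee_fin expR_ge0.
rewrite /eBeta -(ge0_integralZl mu measurableT mb (fun u _ => b0 u) e0).
apply: ge0_le_integral => //.
- by move=> u _; exact: mule_ge0 e0 (b0 u).
- exact: (measurable_funeM _ mb).
move=> u _; rewrite /= -EFinM lee_fin gamma_integrandE beta_integrandE.
case: ltP => u0 /=; last by rewrite mulr0.
case: ltP => u1; last by rewrite mulr0 mulr_ge0 ?powR_ge0 ?expR_ge0.
rewrite subrr powRr0 mulr1 mulrC ler_wpM2l ?powR_ge0 //.
by rewrite ler_expR lerN2 ltW.
Qed.

Lemma GammaS a : 0 < a -> Gamma (a + 1) = a * Gamma a.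
Proof.
move=> a0; apply: EFin_inj; rewrite EFinM !EFin_Gamma ?addr_gt0 //.
rewrite [in RHS]eGamma_recurrence // muleCA -EFinM divff ?mule1 //.
by rewrite gt_eqF.
Qed.

Lemma eBetaE a b : 0 < a -> 0 < b ->
  eBeta a b = (Gamma a * Gamma b / Gamma (a + b))%:E.
Proof.
move=> a0 b0; have ab0 : 0 < a + b by rewrite addr_gt0.
rewrite EFinM muleC EFinM !EFin_Gamma // eGammaM -EFin_Gamma // muleA -EFinM.
by rewrite mulVf ?mul1e // gt_eqF // Gamma_gt0.
Qed.

End gamma_function.

(** * The redistribution law of gKMP *)

Section kmp_density.
Context (R : realType).
Local Notation mu := (@lebesgue_measure R).
Implicit Types a b c d s u : R.

Lemma integrable_beta_integrand a b : 0 < a -> 0 < b ->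
  mu.-integrable setT (EFin \o beta_integrand a b).
Proof.
move=> a0 b0; apply/integrableP; split.
  by apply/measurable_EFinP; exact: measurable_beta_integrand.
under eq_integral do rewrite /= ger0_norm ?beta_integrand_ge0 //.
by rewrite -/(eBeta a b) eBetaE // ltry.
Qed.

Lemma kmp_densityE s u : 0 < u < 1 -> kmp_density s u =
  Gamma (4 * s) / Gamma (2 * s) ^+ 2 * beta_integrand (2 * s) (2 * s) u.
Proof. by move=> u01; rewrite /kmp_density beta_integrandE u01 mulrA. Qed.

(** Multiplication by [u] shifts the first Beta parameter by one. *)
Lemma kmp_densityM s u : 0 < u < 1 -> kmp_density s u * u =
  Gamma (4 * s) / Gamma (2 * s) ^+ 2 * beta_integrand (2 * s + 1) (2 * s) u.
Proof.
move=> u01; rewrite /kmp_density beta_integrandE u01.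
have /andP[u0 _] := u01.
have -> : u `^ (2 * s + 1 - 1) = u `^ (2 * s - 1) * u.
  rewrite -{3}(powRr1 (ltW u0)) -powRD ?(gt_eqF u0) ?implybT //.
  by congr (_ `^ _); ring.
ring.
Qed.

Lemma measurable_kmp_density s : measurable_fun setT (kmp_density s).
Proof.
apply: measurable_funM.
  by apply: measurable_funM => //; exact: measurable_powR.
apply: (@measurableT_comp _ _ _ _ _ _ (@powR R ^~ (2 * s - 1)) _
  (fun u => 1 - u)); first exact: measurable_powR.
exact: measurable_funB.
Qed.

(** The density has total mass 1 and mean 1/2, since
    B(2s + 1, 2s) = 2s / (4s) * B(2s, 2s) by the recurrence. *)
Lemma kmp_density_affine_mean s c d : 0 < s ->
  \int[mu]_(u in `[0, 1]) (kmp_density s u * (c * u + d)) = c / 2 + d.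
Proof.
move=> s0; set M := Gamma (4 * s) / Gamma (2 * s) ^+ 2.
have s20 : 0 < 2 * s by rewrite mulr_gt0.
have s21 : 0 < 2 * s + 1 by rewrite addr_gt0.
have B0 := eBetaE s20 s20; have B1 := eBetaE s21 s20.
have I0 := integrable_beta_integrand s20 s20.
have I1 := integrable_beta_integrand s21 s20.
have pointwise u : (if 0 < u < 1 then kmp_density s u * (c * u + d) else 0) =
    c * M * beta_integrand (2 * s + 1) (2 * s) u +
    d * M * beta_integrand (2 * s) (2 * s) u.
  case: ifP => [u01|u01]; last by rewrite !beta_integrandE u01; ring.
  transitivity (c * (kmp_density s u * u) + d * kmp_density s u); first by ring.
  by rewrite kmp_densityM // kmp_densityE // -/M !mulrA.
transitivity (\int[mu]_u (c * M * beta_integrand (2 * s + 1) (2 * s) u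
    + d * M * beta_integrand (2 * s) (2 * s) u)).
  rewrite /Rintegral integral_itv_bndoo; last first.
    apply: measurable_funTS; apply/measurable_EFinP.
    apply: measurable_funM; first exact: measurable_kmp_density.
    by apply: measurable_funD => //; exact: mulrl_measurable.
  congr fine; rewrite [LHS]integral_mkcond; apply: eq_integral => u _.
  rewrite restrict_EFin /= patchE mem_setE in_itv /=.
  by rewrite -pointwise; case: ifP.
rewrite RintegralD //; last 2 first.
- exact: (integrableZl measurableT (c * M) I1).
- exact: (integrableZl measurableT (d * M) I0).
rewrite !RintegralZl // /Rintegral -/(eBeta _ _) -/(eBeta _ _) B0 B1 /=.
have -> : 2 * s + 1 + 2 * s = 4 * s + 1 by ring.
have -> : 2 * s + 2 * s = 4 * s by ring.
rewrite !GammaS ?mulr_gt0 // /M.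
have G2 : Gamma (2 * s) != 0 by rewrite gt_eqF // Gamma_gt0.
have G4 : Gamma (4 * s) != 0 by rewrite gt_eqF // Gamma_gt0 ?mulr_gt0.
move: (Gamma (2 * s)) (Gamma (4 * s)) G2 G4 => g2 g4 g20 g40.
by field; rewrite g20 g40 gt_eqF.
Qed.

End kmp_density.

(** * The jump rates of the harmonic model *)

Section harmonic_weights.
Context (R : realType).
Implicit Types (alpha : R) (G : R -> R).

(** With S n the sum, the terms for n + 1 are (n + 1) / (n + alpha) times the
    terms for n preceded by the term 1 of index 0, hence
    S (n + 1) = (n + 1) / (n + alpha) * (1 + S n), which n / alpha satisfies.
    Stating this for an abstract solution [G] of the recurrence keeps the
    integral that defines Gamma away from the algebra. *)
Lemma gamma_ratio_sum G alpha n : 0 < alpha ->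
  (forall a, 0 < a -> 0 < G a) -> (forall a, 0 < a -> G (a + 1) = a * G a) ->
  \sum_(0 <= k < n)
    (G (n%:R + 1) * G (n%:R - k.+1%:R + alpha))
    / (G (n%:R - k.+1%:R + 1) * G (n%:R + alpha))
  = n%:R / alpha.
Proof.
move=> alpha0 G0 GS.
pose t m k : R := G (m%:R + 1) * G (m%:R - k%:R + alpha)
  / (G (m%:R - k%:R + 1) * G (m%:R + alpha)).
have t0 m : t m 0%N = 1.
  by rewrite /t !subr0 divff // mulf_neq0 // gt_eqF // G0 // ltr_wpDl.
have tS m k : (k <= m)%N -> t m.+1 k.+1 = (m%:R + 1) / (m%:R + alpha) * t m k.
  move=> km; rewrite /t -!natr1.
  have -> : m%:R + 1 - (k%:R + 1) = m%:R - k%:R :> R by ring.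
  have -> : m%:R + 1 + alpha = m%:R + alpha + 1 by ring.
  rewrite [in LHS](GS (m%:R + 1)) ?ltr_wpDl //.
  rewrite [in LHS](GS (m%:R + alpha)) ?ltr_wpDl //.
  have mk : 0 <= m%:R - k%:R :> R by rewrite subr_ge0 ler_nat.
  have G1 : G (m%:R - k%:R + 1) != 0 by rewrite gt_eqF // G0 // ltr_wpDl.
  have G2 : G (m%:R + alpha) != 0 by rewrite gt_eqF // G0 // ltr_wpDl.
  have ma : m%:R + alpha != 0 by rewrite gt_eqF // ltr_wpDl.
  by field; rewrite G1 G2 ma.
rewrite -/(\sum_(0 <= k < n) t n k.+1).
elim: n => [|n IH]; first by rewrite big_geq // mul0r.
transitivity ((n%:R + 1) / (n%:R + alpha) * \sum_(0 <= k < n.+1) t n k).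
  by rewrite mulr_sumr; apply: eq_big_nat => k /andP[_ kn]; rewrite tS.
rewrite big_nat_recl // t0 IH -natr1.
by field; rewrite !gt_eqF // ltr_wpDl.
Qed.

(** The factor [k] of a jump of size [k] cancels the 1 / k of its rate. *)
Lemma harm_first_moment alpha n : 0 < alpha ->
  \sum_(1 <= k < n.+1)
    (Gamma (n%:R + 1) * Gamma (n%:R - k%:R + alpha))
    / (k%:R * Gamma (n%:R - k%:R + 1) * Gamma (n%:R + alpha)) * k%:R
  = n%:R / alpha.
Proof.
move=> alpha0.
rewrite -(gamma_ratio_sum n alpha0 (@Gamma_gt0 R) (@GammaS R)) big_add1 /=.
apply: eq_bigr => k _.
move: (Gamma _) (Gamma _) (Gamma _) (Gamma _) => g1 g2 g3 g4.
have kS : k.+1%:R != 0 :> R by rewrite pnatr_eq0.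
rewrite -[k.+1%:R * _ * _]mulrA invfM -mulrA; congr (_ * _).
by rewrite mulrAC mulVf // mul1r.
Qed.

End harmonic_weights.

(** * The gradient property *)

Section bonds.
Context (R : realType) (N : nat).
Implicit Types x y : 'Z_N.

(** The two sites of a bond are distinct, because 1 is not 0 in the ring of
    residues, which has at least two elements. *)
Lemma Zp_succ_neq x : (x + 1 == x) = false.
Proof. by rewrite -subr_eq0 addrAC subrr add0r oner_eq0. Qed.

(** The change of each coordinate is affine in [u]: the three cases are
    [kmp_density_affine_mean] for different coefficients. *)
Lemma gKMP_bond_coordinate (s : R) x y (eta : {ffun 'Z_N -> R}) : 0 < s ->
  gKMP_bond s x (fun zeta => zeta y) eta =
  1 / 2 * (eta (x + 1) - eta x) * ((y == x)%:R - (y == x + 1)%:R).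
Proof.
move=> s0; set c := eta x + eta (x + 1).
have drift (d e : R) :
    (forall u : R, kmp_move x (x + 1) u eta y - eta y = d * u + e) ->
    gKMP_bond s x (fun zeta => zeta y) eta = d / 2 + e.
  move=> moveE; rewrite -(kmp_density_affine_mean d e s0).
  by apply: eq_Rintegral => u _; rewrite moveE.
have [yx|yx] := eqVneq y x.
  rewrite (drift c (- eta x)) => [|u]; last by rewrite ffunE yx eqxx -/c; ring.
  by rewrite yx eq_sym Zp_succ_neq /c /=; field.
have [yx1|yx1] := eqVneq y (x + 1).
  rewrite (drift (- c) (c - eta (x + 1))) => [|u].
    by rewrite /c /=; field.
  by rewrite ffunE yx1 Zp_succ_neq eqxx -/c; ring.
rewrite (drift 0 0) => [|u]; first by rewrite /=; ring.
by rewrite ffunE (negPf yx) (negPf yx1); ring.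
Qed.

Lemma dKMP_bond_coordinate x y (eta : {ffun 'Z_N -> nat}) :
  dKMP_bond x (fun zeta => (zeta y)%:R) eta =
  1 / 2 * ((eta (x + 1))%:R - (eta x)%:R) *
    ((y == x)%:R - (y == x + 1)%:R) :> R.
Proof.
rewrite /dKMP_bond.
set n := (eta x + eta (x + 1)%R)%N.
have n1 : (n + 1)%:R != 0 :> R by rewrite pnatr_eq0 addn1.
have sum_id : \sum_(0 <= r < n.+1) r%:R = n%:R * (n + 1)%:R / 2 :> R.
  elim: n {n1} => [|m IH]; first by rewrite big_nat1 !mul0r.
  by rewrite big_nat_recr //= IH -[m.+1]addn1 !natrD; field.
have nE : n%:R = (eta x)%:R + (eta (x + 1))%:R :> R by rewrite natrD.
have drift (c d : R) : 1 / (n + 1)%:R * \sum_(0 <= r < n.+1) (c * r%:R + d) =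
    c * (n%:R / 2) + d.
  rewrite big_split /= -mulr_sumr sum_id sumr_const_nat subn0 -addn1.
  by rewrite -[d *+ _]mulr_natr; field.
have [->|yx] := eqVneq y x.
  rewrite eq_sym Zp_succ_neq.
  transitivity (1 / (n + 1)%:R *
      \sum_(0 <= r < n.+1) (1 * r%:R + - (eta x)%:R) : R).
    by congr (_ * _); apply: eq_bigr => r _; rewrite ffunE eqxx mul1r.
  by rewrite drift nE /=; field.
have [->|yx1] := eqVneq y (x + 1).
  transitivity (1 / (n + 1)%:R *
      \sum_(0 <= r < n.+1) (-1 * r%:R + (n%:R - (eta (x + 1))%:R)) : R).
    congr (_ * _); apply: eq_big_nat => r /andP[_ rn].
    by rewrite ffunE Zp_succ_neq eqxx -/n natrB //; ring.
  by rewrite drift nE /=; field.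
rewrite subrr mulr0 big1 ?mulr0 // => r _.
by rewrite ffunE (negPf yx) (negPf yx1) subrr.
Qed.

Lemma nabla_Harm_coordinate (s : R) x z y (eta : {ffun 'Z_N -> nat}) :
  0 < s -> x != z ->
  nabla_Harm s x z (fun zeta => (zeta y)%:R) eta =
  (eta x)%:R / (2 * s) * ((y == z)%:R - (y == x)%:R).
Proof.
move=> s0 xz; rewrite -harm_first_moment ?mulr_gt0 // mulr_suml.
apply: eq_big_nat => k /andP[_ kx]; rewrite -[RHS]mulrA; congr (_ * _).
rewrite ffunE; have [->|yx] := eqVneq y x.
  by rewrite (negPf xz) muln1 muln0 addn0 natrB //=; ring.
by rewrite muln0 subn0 natrD natrM /=; ring.
Qed.

Lemma Harm_bond_coordinate (s : R) x y (eta : {ffun 'Z_N -> nat}) : 0 < s ->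
  Harm_bond s x (fun zeta => (zeta y)%:R) eta =
  1 / (2 * s) * ((eta (x + 1))%:R - (eta x)%:R) *
    ((y == x)%:R - (y == x + 1)%:R).
Proof.
move=> s0.
rewrite /Harm_bond !nabla_Harm_coordinate ?Zp_succ_neq //; last first.
  by rewrite eq_sym Zp_succ_neq.
by ring.
Qed.

(** The action of one bond on all coordinates at once: what site [x] gains,
    site [x + 1] loses, and the other sites do not change. *)
Lemma bond_generator_coordinate (sigma : model R) x y (eta : config N sigma) :
  admissible sigma ->
  bond_generator x (coordinate y) eta =
  diffusivity sigma * (coordinate (x + 1) eta - coordinate x eta) *
    ((y == x)%:R - (y == x + 1)%:R).
Proof.
case: sigma eta => [s|/=|s] eta /=.
- exact: gKMP_bond_coordinate.
- by move=> _; exact: dKMP_bond_coordinate.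
- by move=> s12; apply: Harm_bond_coordinate; lra.
Qed.

(** Only the bonds starting at [y] and at [y - 1] act on the coordinate [y]. *)
Lemma generator_coordinate (sigma : model R) y (eta : config N sigma) :
  admissible sigma ->
  generator (coordinate y) eta =
  diffusivity sigma * (coordinate (y + 1) eta + coordinate (y - 1) eta
    - 2 * coordinate y eta).
Proof.
move=> adm; rewrite /generator.
pose g x := diffusivity sigma * (coordinate (x + 1) eta - coordinate x eta).
transitivity (\sum_x (g x *+ (x == y) - g x *+ (x == y - 1))).
  apply: eq_bigr => x _; rewrite bond_generator_coordinate // mulrBr.
  by rewrite !mulr_natr [y == x]eq_sym [x == y - 1]eq_sym subr_eq.
have pick z : \sum_x g x *+ (x == z) = g z.
  by rewrite (bigD1 z) //= eqxx big1 ?addr0 // => x /negPf ->.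
rewrite sumrB !pick /g subrK; ring.
Qed.

End bonds.

Theorem mainTheorem5 (R : realType) (N : nat) (hN : (2 <= N)%N)
    (sigma : model R) (hsigma : admissible sigma) :
  (forall (x : 'Z_N) (eta : config N sigma), Omega eta ->
     bond_generator x (coordinate x) eta =
     diffusivity sigma * (coordinate (x + 1) eta - coordinate x eta)) /\
  (forall (x : 'Z_N) (eta : config N sigma), Omega eta ->
     N%:R ^+ 2 * generator (coordinate x) eta =
     diffusivity sigma * N%:R ^+ 2 *
       (coordinate (x + 1) eta + coordinate (x - 1) eta - 2 * coordinate x eta)).
Proof.
split=> x eta _; last by rewrite generator_coordinate // mulrCA mulrA.
rewrite bond_generator_coordinate // eqxx eq_sym.
by rewrite Zp_succ_neq subr0 mulr1.
Qed.
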